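(* Let $\mathcal{H}=(H,\cdot,\mathbin{:})$ be a Hopf $q$-brace over a field $k$, with $S$ the antipode of $H$. For all $j\in\mathbb{N}$ and $h,k\in H$, we have $$S^j(h)\cdot k=S^j\Bigl(h_{(i_1)}\cdot\Bigl(\bigl(\cdots\bigl((k\mathbin{:}S^j(h_{(i_2)}))\mathbin{:}S^{j-1}(h_{(i_3)})\bigr)\cdots\mathbin{:}S^2(h_{(i_j)})\bigr)\mathbin{:}S(h_{(i_{j+1})})\Bigr)\Bigr)$$ and $$S^j(h)\mathbin{:}k=S^j\Bigl(h_{(i_1)}\mathbin{:}\Bigl(\bigl(\cdots\bigl((k\cdot S^j(h_{(i_2)}))\cdot S^{j-1}(h_{(i_3)})\bigr)\cdots\cdot S^2(h_{(i_j)})\bigr)\cdot S(h_{(i_{j+1})})\Bigr)\Bigr),$$ where $$(i_1,\dots,i_{j+1}):=\begin{cases}(n+1,1,2n+1,2,2n,3,\dots,n-1,n+3,n,n+2)&\text{if }j=2n,\\(n+1,2n+2,1,2n+1,2,2n,\dots,n-1,n+3,n,n+2)&\text{if }j=2n+1.\end{cases}$$ For example, for $j=1,2,3,4,5,6$ the tuples are $(1,2)$, $(2,1,3)$, $(2,4,1,3)$, $(3,1,5,2,4)$, $(3,6,1,5,2,4)$ and $(4,1,7,2,6,3,5)$, respectively.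
   Context: All vector spaces, maps and tensor products are over $k$ (maps are linear); Sweedler notation is used, with $h_{(1)}\otimes\cdots\otimes h_{(j+1)}$ the iterated comultiplication of $h$; $\epsilon$ is the counit; $\mathbb{N}=\{1,2,\dots\}$; $S^j$ is the $j$-fold composition of $S$; $H^{\mathrm{cop}}$, $H^{\mathrm{op}}$ denote opposite coalgebra/algebra. Multiplication in $H$ binds tighter than $\cdot$ and $\mathbin{:}$. Let $H$ be a Hopf algebra. A triple $(H,\cdot,\mathbin{:})$ with linear maps $\cdot,\mathbin{:}\colon H\otimes H\to H$ satisfying $\epsilon(x\cdot y)=\epsilon(x\mathbin{:}y)=\epsilon(x)\epsilon(y)$ is a $q$-magma coalgebra if $H\otimes H^{\mathrm{cop}}\to H^{\mathrm{cop}}\otimes H$, $x\otimes y\mapsto y_{(1)}\mathbin{:}x_{(2)}\otimes x_{(1)}\cdot y_{(2)}$, is a coalgebra morphism; left regular if $x\otimes y\mapsto x\cdot y_{(1)}\otimes y_{(2)}$ is invertible; a $q$-cycle coalgebra if it is left regular and for all $x,y,z$: $(x\cdot y_{(1)})\cdot(z\mathbin{:}y_{(2)})=(x\cdot z_{(2)})\cdot(y\cdot z_{(1)})$, $(x\cdot y_{(1)})\mathbin{:}(z\cdot y_{(2)})=(x\mathbin{:}z_{(2)})\cdot(y\mathbin{:}z_{(1)})$, $(x\mathbin{:}y_{(1)})\mathbin{:}(z\mathbin{:}y_{(2)})=(x\mathbin{:}z_{(2)})\mathbin{:}(y\cdot z_{(1)})$. It is a Hopf $q$-brace if it is a $q$-cycle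 coalgebra, $H$ is a right $H^{\mathrm{op}}$-module via $\cdot$ and via $\mathbin{:}$ (that is, $h\cdot1=h$, $h\cdot kl=(h\cdot l)\cdot k$ and likewise for $\mathbin{:}$), and $hk\cdot l=(h\cdot(l_{(1)}\mathbin{:}k_{(2)}))(k_{(1)}\cdot l_{(2)})$ and $hk\mathbin{:}l=(h\mathbin{:}(l_{(1)}\cdot k_{(2)}))(k_{(1)}\mathbin{:}l_{(2)})$ for all $h,k,l\in H$. *)

(* Defs.v *)
From HB Require Import structures.
From mathcomp Require Import all_boot all_algebra boolp.

Set Implicit Arguments.
Unset Strict Implicit.
Unset Printing Implicit Defensive.

Import GRing.Theory.
Local Open Scope ring_scope.
Local Open Scope quotient_scope.

Notation is_bilinear f := (bilinear_for *:%R *:%R f).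

(* MathComp has no tensor product of arbitrary vector spaces.  A tensor is a
   class of formal finite sums [:: (u_1, v_1); ...; (u_n, v_n)], two of them
   being identified when no bilinear map out of U x V separates them.  The
   universal property is proved below ([tens_bilinear], [tlift_tens],
   [tlift_linear], [tlift_unique]), so this is the usual tensor product. *)

Section TensorProduct.
Variables (k : fieldType) (U V : lmodType k).

Definition fsum (W : nmodType) (f : U -> V -> W) (s : seq (U * V)) : W :=
  \sum_(p <- s) f p.1 p.2.

Definition tens_rel (s t : seq (U * V)) : bool :=
  `[< forall (W : lmodType k) (f : U -> V -> W),
        is_bilinear f -> fsum f s = fsum f t >].

Lemma tens_rel_equiv : equiv_class_of tens_rel.
Proof.
split=> [s | s t | s t r].
- exact/asboolP.
- by apply/asboolP/asboolP => E W f /E.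
- by move=> /asboolP E1 /asboolP E2; apply/asboolP => W f bf; rewrite E1 ?E2.
Qed.

Canonical tens_rel_equivrel := EquivRelPack tens_rel_equiv.

Definition tensor := {eq_quot tens_rel}.

HB.instance Definition _ := EqQuotient.on tensor.
HB.instance Definition _ := Choice.on tensor.

Definition tlift (W : nmodType) (f : U -> V -> W) (t : tensor) : W :=
  fsum f (repr t).

Definition tens (u : U) (v : V) : tensor := \pi_tensor [:: (u, v)].

Lemma tlift_pi (W : lmodType k) (f : U -> V -> W) s :
  is_bilinear f -> tlift f (\pi_tensor s) = fsum f s.
Proof.
move=> bf; have /eqmodP/asboolP E : repr (\pi_tensor s) = s %[mod tensor].
  by rewrite reprK.
exact: E.
Qed.

Lemma tensor_eqP (s t : seq (U * V)) :
  (forall (W : lmodType k) (f : U -> V -> W),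
     is_bilinear f -> fsum f s = fsum f t) ->
  \pi_tensor s = \pi_tensor t.
Proof. by move=> E; apply/eqmodP/asboolP. Qed.

Definition tens0 : tensor := \pi_tensor [::].
Definition tens_add (x y : tensor) : tensor := \pi_tensor (repr x ++ repr y).
Definition tens_scale (a : k) (x : tensor) : tensor :=
  \pi_tensor [seq (a *: p.1, p.2) | p <- repr x].

Lemma tensor_ext (x y : tensor) :
  (forall (W : lmodType k) (f : U -> V -> W),
     is_bilinear f -> tlift f x = tlift f y) -> x = y.
Proof.
by move=> E; rewrite -[x]reprK -[y]reprK; apply: tensor_eqP => W f /E.
Qed.

Lemma tlift0_ (W : lmodType k) (f : U -> V -> W) :
  is_bilinear f -> tlift f tens0 = 0.
Proof. by move=> bf; rewrite tlift_pi // /fsum big_nil. Qed.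

Lemma tliftD_ (W : lmodType k) (f : U -> V -> W) x y :
  is_bilinear f -> tlift f (tens_add x y) = tlift f x + tlift f y.
Proof. by move=> bf; rewrite tlift_pi // /fsum big_cat. Qed.

Lemma tliftZ_ (W : lmodType k) (f : U -> V -> W) a x :
  is_bilinear f -> tlift f (tens_scale a x) = a *: tlift f x.
Proof.
move=> bf; rewrite tlift_pi // /fsum big_map scaler_sumr.
apply: eq_bigr => p _ /=.
exact: (scalable_linear (bf.1 p.2)).
Qed.

Lemma tens_addA : associative tens_add.
Proof.
by move=> x y z; apply: tensor_ext => W f bf; rewrite !tliftD_ // addrA.
Qed.

Lemma tens_addC : commutative tens_add.
Proof.
by move=> x y; apply: tensor_ext => W f bf; rewrite !tliftD_ // addrC.
Qed.

Lemma tens_add0 : left_id tens0 tens_add.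
Proof.
by move=> x; apply: tensor_ext => W f bf; rewrite tliftD_ // tlift0_ // add0r.
Qed.

Lemma tens_addN : left_inverse tens0 (tens_scale (-1)) tens_add.
Proof.
move=> x; apply: tensor_ext => W f bf.
by rewrite tliftD_ // tliftZ_ // tlift0_ // scaleN1r addNr.
Qed.

HB.instance Definition _ :=
  GRing.isZmodule.Build tensor tens_addA tens_addC tens_add0 tens_addN.

Fact tens_scaleA a b x : tens_scale a (tens_scale b x) = tens_scale (a * b) x.
Proof. by apply: tensor_ext => W f bf; rewrite !tliftZ_ // scalerA. Qed.

Fact tens_scale1 : left_id 1 tens_scale.
Proof. by move=> x; apply: tensor_ext => W f bf; rewrite tliftZ_ // scale1r. Qed.

Fact tens_scaleDr : right_distributive tens_scale +%R.
Proof.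
move=> a x y; apply: tensor_ext => W f bf.
by rewrite tliftZ_ // [RHS]tliftD_ // [in LHS]tliftD_ // scalerDr !tliftZ_.
Qed.

Fact tens_scaleDl x : {morph tens_scale^~ x : a b / a + b}.
Proof.
move=> a b; apply: tensor_ext => W f bf.
by rewrite tliftZ_ // [RHS]tliftD_ // scalerDl !tliftZ_.
Qed.

HB.instance Definition _ := GRing.Zmodule_isLmodule.Build k tensor
  tens_scaleA tens_scale1 tens_scaleDr tens_scaleDl.

Lemma tlift_tens (W : lmodType k) (f : U -> V -> W) u v :
  is_bilinear f -> tlift f (tens u v) = f u v.
Proof. by move=> bf; rewrite tlift_pi // /fsum big_seq1. Qed.

Lemma tlift_linear (W : lmodType k) (f : U -> V -> W) :
  is_bilinear f -> linear (tlift f).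
Proof. by move=> bf a x y; rewrite [LHS]tliftD_ // tliftZ_. Qed.

Lemma tens_bilinear : is_bilinear tens.
Proof.
by split=> [v | u] a x y; apply: tensor_ext => W f bf;
  rewrite [RHS]tliftD_ // tliftZ_ // !tlift_tens // ?(bf.1 v) ?(bf.2 u).
Qed.

Lemma tensorE (t : tensor) : t = \sum_(p <- repr t) tens p.1 p.2.
Proof.
apply: tensor_ext => W f bf.
have L := tlift_linear bf.
pose g : {linear tensor -> W} :=
  HB.pack (tlift f) (GRing.isLinear.Build _ _ _ _ (tlift f) L).
rewrite -[RHS]/(g _) linear_sum /=.
by apply: eq_bigr => p _; rewrite tlift_tens.
Qed.

Lemma tlift_unique (W : lmodType k) (f : U -> V -> W) (g : tensor -> W) :
  linear g -> (forall u v, g (tens u v) = f u v) -> g =1 tlift f.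
Proof.
move=> L E t.
pose g' : {linear tensor -> W} :=
  HB.pack g (GRing.isLinear.Build _ _ _ _ g L).
rewrite {1}[t]tensorE -[LHS]/(g' _) linear_sum /=.
by apply: eq_bigr => p _; rewrite E.
Qed.


Lemma tens_ext (W : lmodType k) (f g : tensor -> W) :
  linear f -> linear g -> (forall u v, f (tens u v) = g (tens u v)) -> f =1 g.
Proof.
move=> Lf Lg E t.
by rewrite (tlift_unique Lf E) -(tlift_unique Lg (fun u v => erefl)).
Qed.

End TensorProduct.

Notation "u ⊗ v" := (tens u v) (at level 45, no associativity) : ring_scope.

Definition mklinear (k : fieldType) (V W : lmodType k) (f : V -> W)
    (Lf : linear f) : {linear V -> W} :=
  HB.pack f (GRing.isLinear.Build _ _ _ _ f Lf).

(* Sweedler sums: [\tsum_(a, b <- t) E] is sum_i E(a_i, b_i) for a decomposition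
   t = sum_i a_i ⊗ b_i, and [\sw_(a, b <- x) E] is sum E(x_(1), x_(2)).  They do
   not depend on the decomposition as soon as E is bilinear in (a, b), which
   is the case in all uses below. *)
Notation "\tsum_ ( a , b <- t ) E" := (tlift (fun a b => E) t)
  (at level 41, E at level 41, a name, b name, t at level 50,
   format "\tsum_ ( a ,  b  <-  t )  E") : ring_scope.

HB.mixin Record Lmodule_isCoalgebra (k : fieldType) C of GRing.Lmodule k C := {
  comul : {linear C -> tensor C C};
  counit : {scalar C};
  coassoc : forall x : C,
    \tsum_(a, b <- comul x) \tsum_(a1, a2 <- comul a) (a1 ⊗ (a2 ⊗ b)) =
    \tsum_(a, b <- comul x) \tsum_(b1, b2 <- comul b) (a ⊗ (b1 ⊗ b2));
  counitl : forall x : C, \tsum_(a, b <- comul x) (counit a *: b) = x;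
  counitr : forall x : C, \tsum_(a, b <- comul x) (counit b *: a) = x
}.

#[short(type="coalgType")]
HB.structure Definition Coalgebra (k : fieldType) :=
  { C of GRing.Lmodule k C & Lmodule_isCoalgebra k C }.

Notation "\sw_ ( a , b <- x ) E" := (\tsum_(a, b <- comul x) E)
  (at level 41, E at level 41, a name, b name, x at level 50,
   format "\sw_ ( a ,  b  <-  x )  E") : ring_scope.

Section CoalgebraTheory.
Variables (k : fieldType).

Definition coalgebra_morphism (C D : coalgType k) (f : C -> D) : Prop :=
  [/\ linear f,
      forall c, comul (f c) = \sw_(c1, c2 <- c) (f c1 ⊗ f c2)
    & forall c, counit (f c) = counit c].

Lemma tlift_comp (U V : lmodType k) (W X : lmodType k) (f : U -> V -> W)
    (g : W -> X) t :
  linear g -> g (tlift f t) = tlift (fun u v => g (f u v)) t.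
Proof.
by move=> Lg; rewrite -[LHS]/(mklinear Lg _) /tlift /fsum linear_sum.
Qed.

Lemma tlift_paramL (U V : lmodType k) (X W : lmodType k)
    (f : X -> U -> V -> W) t :
  (forall u v, linear (fun x => f x u v)) -> linear (fun x => tlift (f x) t).
Proof.
move=> L a x y; rewrite /tlift /fsum scaler_sumr -big_split.
by apply: eq_bigr => p _; rewrite L.
Qed.

Lemma sw_linear (C : coalgType k) (W : lmodType k) (f : C -> C -> W) :
  is_bilinear f -> linear (fun x => \sw_(a, b <- x) f a b).
Proof. by move=> bf a x y; rewrite linearP tlift_linear. Qed.

Lemma tlift_exchange (U V U' V' : lmodType k) (W : nmodType)
    (f : U -> V -> U' -> V' -> W) t s :
  \tsum_(a, b <- t) \tsum_(c, d <- s) f a b c d =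
  \tsum_(c, d <- s) \tsum_(a, b <- t) f a b c d.
Proof. exact: exchange_big. Qed.

Lemma eq_tlift (U V : lmodType k) (W : nmodType) (f g : U -> V -> W) t :
  f =2 g -> tlift f t = tlift g t.
Proof. by move=> E; apply: eq_bigr => p _; apply: E. Qed.

Definition trilinear (U V X W : lmodType k) (f : U -> V -> X -> W) :=
  [/\ forall v x, linear (fun u => f u v x),
      forall u x, linear (fun v => f u v x)
    & forall u v, linear (fun x => f u v x)].

Lemma coassocE (C : coalgType k) (W : lmodType k) (f : C -> C -> C -> W) x :
  trilinear f ->
  \sw_(a, b <- x) \sw_(a1, a2 <- a) f a1 a2 b =
  \sw_(a, b <- x) \sw_(b1, b2 <- b) f a b1 b2.
Proof.
move=> [f1 f2 f3].
pose g a (t : tensor C C) := \tsum_(b, c <- t) f a b c.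
have bg a : is_bilinear (f a) by split=> [v|u]; [exact: f2 | exact: f3].
have Lg a : linear (g a) by exact: tlift_linear.
have bbg : is_bilinear g.
  split=> [t | a]; last exact: Lg.
  by apply: tlift_paramL => u v; exact: f1.
have Lh : linear (fun t => \tsum_(a, s <- t) g a s) by exact: tlift_linear.
have := congr1 (fun t => \tsum_(a, s <- t) g a s) (coassoc x).
rewrite !(tlift_comp _ _ Lh).
under eq_tlift => a b do rewrite (tlift_comp _ _ Lh).
under [in RHS]eq_tlift => a b do rewrite (tlift_comp _ _ Lh).
under eq_tlift => a b do under eq_tlift => a1 a2 do
  rewrite tlift_tens // [g _ _]tlift_tens //.
by under [in RHS]eq_tlift => a b do under eq_tlift => a1 a2 do
  rewrite tlift_tens // [g _ _]tlift_tens //.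
Qed.

End CoalgebraTheory.

Section Multilinear.
Variables (k : fieldType) (U U' V V' X W : lmodType k).

Lemma bilinear_flip (f : U -> V -> W) :
  is_bilinear f -> is_bilinear (fun v u => f u v).
Proof. by case=> f1 f2; split=> [u | v]; [exact: f2 | exact: f1]. Qed.

Lemma bilinear_comp (f : U -> V -> W) (g : U' -> U) (h : V' -> V) :
  is_bilinear f -> linear g -> linear h ->
  is_bilinear (fun u v => f (g u) (h v)).
Proof.
by move=> [f1 f2] Lg Lh; split=> u a x y /=; rewrite (Lg, Lh) (f1, f2).
Qed.

Lemma trilinear_tliftl (f : U -> V -> X -> W) (D : U' -> tensor U V) :
  trilinear f -> linear D ->
  is_bilinear (fun u x => tlift (fun a b => f a b x) (D u)).
Proof.
move=> [f1 f2 f3] LD; split=> [x | u].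
- by move=> a u v /=; rewrite LD tlift_linear.
- exact: (tlift_paramL (D u) f3).
Qed.

Lemma trilinear_tliftr (f : X -> U -> V -> W) (D : U' -> tensor U V) :
  trilinear f -> linear D ->
  is_bilinear (fun x u => tlift (f x) (D u)).
Proof.
move=> [f1 f2 f3] LD; split=> [u | x]; first exact: (tlift_paramL (D u) f1).
by move=> a u v /=; rewrite LD tlift_linear.
Qed.

Lemma trilinear_tens : trilinear (fun (u : U) (v : V) (x : X) => u ⊗ (v ⊗ x)).
Proof.
have [l r] := @tens_bilinear k U (tensor V X).
have [l' r'] := @tens_bilinear k V X.
split=> [v x | u x | u v] a y z /=; first exact: l.
- by rewrite l' r.
- by rewrite r' r.
Qed.

End Multilinear.

Section Cop.
Variable k : fieldType.

Definition cop (C : Type) : Type := C.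

HB.instance Definition _ (C : lmodType k) := GRing.Lmodule.on (cop C).

Variable C : coalgType k.

Definition cop_comul (x : cop C) : tensor (cop C) (cop C) :=
  \sw_(a, b <- (x : C)) ((b : cop C) ⊗ (a : cop C)).

Let swap_bilinear :
  is_bilinear (fun a b : C => (b : cop C) ⊗ (a : cop C)).
Proof. by split=> [b | a]; [exact: (tens_bilinear _ _).2 | exact: (tens_bilinear _ _).1]. Qed.

Fact cop_comul_linear : linear cop_comul.
Proof. exact: (sw_linear swap_bilinear). Qed.

Lemma tlift_cop (W : lmodType k) (f : cop C -> cop C -> W) x :
  is_bilinear f -> tlift f (cop_comul x) = \sw_(a, b <- (x : C)) f b a.
Proof.
move=> bf; rewrite (tlift_comp _ _ (tlift_linear bf)).
by apply: eq_tlift => a b; rewrite tlift_tens.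
Qed.

Let copD := mklinear cop_comul_linear.
Let cope : {scalar cop C} := (counit : {scalar C}).

Fact cop_coassoc (x : cop C) :
  \tsum_(a, b <- copD x) \tsum_(a1, a2 <- copD a) (a1 ⊗ (a2 ⊗ b)) =
  \tsum_(a, b <- copD x) \tsum_(b1, b2 <- copD b) (a ⊗ (b1 ⊗ b2)).
Proof.
have T := @trilinear_tens k (cop C) (cop C) (cop C).
rewrite !tlift_cop; last 2 first.
- exact: (trilinear_tliftr T cop_comul_linear).
- exact: (trilinear_tliftl T cop_comul_linear).
under eq_tlift => a b.
  rewrite tlift_cop; last by split=> ?; [case: T | case: T].
  over.
under [RHS]eq_tlift => a b.
  rewrite tlift_cop; last by split=> ?; [case: T | case: T].
  over.
rewrite -(@coassocE k C _ (fun a b c => (c : cop C) ⊗ ((b : cop C) ⊗ (a : cop C)))) //.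
by case: T => t1 t2 t3; split=> *; [exact: t3 | exact: t2 | exact: t1].
Qed.

Fact cop_counitl (x : cop C) : \tsum_(a, b <- copD x) (cope a *: b) = x.
Proof.
rewrite tlift_cop; first exact: (@counitr k C).
split=> [b | a] c u v /=; last by rewrite scalerDr !scalerA mulrC.
by rewrite linearP scalerDl scalerA.
Qed.

Fact cop_counitr (x : cop C) : \tsum_(a, b <- copD x) (cope b *: a) = x.
Proof.
rewrite tlift_cop; first exact: (@counitl k C).
split=> [b | a] c u v /=; first by rewrite scalerDr !scalerA mulrC.
by rewrite linearP scalerDl scalerA.
Qed.

HB.instance Definition _ := Lmodule_isCoalgebra.Build k (cop C)
  cop_coassoc cop_counitl cop_counitr.

End Cop.

Section TensorCoalgebra.
Variables (k : fieldType) (C D : coalgType k).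

Definition tensor_comul : tensor C D -> tensor (tensor C D) (tensor C D) :=
  tlift (fun (c : C) (d : D) =>
    \sw_(c1, c2 <- c) \sw_(d1, d2 <- d) ((c1 ⊗ d1) ⊗ (c2 ⊗ d2))).

Definition tensor_counit : tensor C D -> k^o :=
  tlift (fun (c : C) (d : D) => (counit c * counit d : k^o)).

Lemma sw2_bilinear (W : lmodType k) (f : C -> C -> D -> D -> W) :
  (forall d1 d2, is_bilinear (fun c1 c2 => f c1 c2 d1 d2)) ->
  (forall c1 c2, is_bilinear (f c1 c2)) ->
  is_bilinear (fun c d => \sw_(c1, c2 <- c) \sw_(d1, d2 <- d) f c1 c2 d1 d2).
Proof.
move=> bc bd; split=> [d | c].
- apply: (@sw_linear k C W).
  split=> c; apply: tlift_paramL => d1 d2.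
  + exact: (bc d1 d2).1.
  + exact: (bc d1 d2).2.
- apply: tlift_paramL => c1 c2; exact: (@sw_linear k D W).
Qed.

Lemma tens2_bilinear (W : lmodType k) (G : tensor C D -> tensor C D -> W) :
  is_bilinear G ->
  is_bilinear (fun c d => \sw_(c1, c2 <- c) \sw_(d1, d2 <- d)
                            G (c1 ⊗ d1) (c2 ⊗ d2)).
Proof.
move=> bG; have [l r] := @tens_bilinear k C D.
by apply: sw2_bilinear => [d1 d2 | c1 c2]; apply: bilinear_comp.
Qed.

Lemma tensor_comul_linear : linear tensor_comul.
Proof.
by apply: tlift_linear; apply: (tens2_bilinear (@tens_bilinear k _ _)).
Qed.

Let tD := mklinear tensor_comul_linear.

Lemma counit2_bilinear :
  is_bilinear (fun (c : C) (d : D) => (counit c * counit d : k^o)).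
Proof.
split=> [d | c] a x y /=; rewrite linearP.
- by rewrite mulrDl -mulrA.
- by rewrite mulrDr mulrCA.
Qed.

Lemma tensor_counit_linear : linear tensor_counit.
Proof. exact: tlift_linear counit2_bilinear. Qed.

Let te : {scalar tensor C D} := mklinear tensor_counit_linear.

Lemma tlift_tensor_comul (W : lmodType k) (G : tensor C D -> tensor C D -> W)
    (c : C) (d : D) :
  is_bilinear G ->
  tlift G (tensor_comul (c ⊗ d)) =
  \sw_(c1, c2 <- c) \sw_(d1, d2 <- d) G (c1 ⊗ d1) (c2 ⊗ d2).
Proof.
move=> bG; have LG := tlift_linear bG.
rewrite [tensor_comul _]tlift_tens; last first.
  exact: (tens2_bilinear (@tens_bilinear k _ _)).
rewrite (tlift_comp _ _ LG); apply: eq_tlift => c1 c2.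
by rewrite (tlift_comp _ _ LG); apply: eq_tlift => d1 d2; rewrite tlift_tens.
Qed.

Fact tensor_coassoc (x : tensor C D) :
  \tsum_(a, b <- tD x) \tsum_(a1, a2 <- tD a) (a1 ⊗ (a2 ⊗ b)) =
  \tsum_(a, b <- tD x) \tsum_(b1, b2 <- tD b) (a ⊗ (b1 ⊗ b2)).
Proof.
have T := @trilinear_tens k (tensor C D) (tensor C D) (tensor C D).
have bl := trilinear_tliftl T tensor_comul_linear.
have br := trilinear_tliftr T tensor_comul_linear.
move: x; apply: tens_ext => [||c d].
- by move=> a x y /=; rewrite tensor_comul_linear tlift_linear.
- by move=> a x y /=; rewrite tensor_comul_linear tlift_linear.
rewrite !tlift_tensor_comul //.
pose F c1 c2 c3 d1 d2 d3 : tensor (tensor C D) _ :=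
  (c1 ⊗ d1) ⊗ ((c2 ⊗ d2) ⊗ (c3 ⊗ d3) : tensor (tensor C D) (tensor C D)).
have [l r] := @tens_bilinear k C D.
have [t1 t2 t3] := T.
have Fd c1 c2 c3 : trilinear (F c1 c2 c3).
  by split=> u v a x y; rewrite /F r (t1, t2, t3).
have Fc d1 d2 d3 : trilinear (fun c1 c2 c3 => F c1 c2 c3 d1 d2 d3).
  by split=> u v a x y; rewrite /F l (t1, t2, t3).
pose H c1 c2 c3 := \sw_(a, b <- d) \sw_(b1, b2 <- b) F c1 c2 c3 a b1 b2.
have TH : trilinear H.
  split=> u v; apply: tlift_paramL => d1 d2; apply: tlift_paramL => b1 b2.
  - by case: (Fc d1 b1 b2).
  - by case: (Fc d1 b1 b2).
  - by case: (Fc d1 b1 b2).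
transitivity (\sw_(a, b <- c) \sw_(a1, a2 <- a) H a1 a2 b).
  apply: eq_tlift => c1 c2.
  under eq_tlift => d1 d2.
    rewrite tlift_tensor_comul; last by split=> ?; [exact: t1 | exact: t2].
    over.
  rewrite tlift_exchange; apply: eq_tlift => c11 c12.
  by rewrite /H -coassocE.
rewrite coassocE //; apply: eq_tlift => c1 c2.
under [RHS]eq_tlift => d1 d2.
  rewrite tlift_tensor_comul; last by split=> ?; [exact: t2 | exact: t3].
  over.
by rewrite [RHS]tlift_exchange.
Qed.

Fact tensor_counitl (x : tensor C D) : \tsum_(a, b <- tD x) (te a *: b) = x.
Proof.
have B : is_bilinear (fun a b : tensor C D => te a *: b).
  split=> [b | a] c u v /=; last by rewrite scalerDr !scalerA mulrC.
  by rewrite (tensor_counit_linear c u v) scalerDl scalerA.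
move: x; apply: tens_ext => [||c d] //.
  by move=> a x y /=; rewrite tensor_comul_linear tlift_linear.
rewrite tlift_tensor_comul //= /tensor_counit.
have [l r] := @tens_bilinear k C D.
transitivity (\sw_(c1, c2 <- c) \sw_(d1, d2 <- d)
                ((counit c1 *: c2) ⊗ (counit d1 *: d2))).
  apply: eq_tlift => c1 c2; apply: eq_tlift => d1 d2.
  rewrite (tlift_tens _ _ counit2_bilinear).
  by rewrite (scalable_linear (l _)) (scalable_linear (r _)) /= scalerA.
rewrite -{2}(counitl c) -{2}(counitl d) (tlift_comp _ _ (l _)).
by apply: eq_tlift => c1 c2; rewrite (tlift_comp _ _ (r _)).
Qed.

Fact tensor_counitr (x : tensor C D) : \tsum_(a, b <- tD x) (te b *: a) = x.
Proof.
have B : is_bilinear (fun a b : tensor C D => te b *: a).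
  split=> [b | a] c u v /=; first by rewrite scalerDr !scalerA mulrC.
  by rewrite (tensor_counit_linear c u v) scalerDl scalerA.
move: x; apply: tens_ext => [||c d] //.
  by move=> a x y /=; rewrite tensor_comul_linear tlift_linear.
rewrite tlift_tensor_comul //= /tensor_counit.
have [l r] := @tens_bilinear k C D.
transitivity (\sw_(c1, c2 <- c) \sw_(d1, d2 <- d)
                ((counit c2 *: c1) ⊗ (counit d2 *: d1))).
  apply: eq_tlift => c1 c2; apply: eq_tlift => d1 d2.
  rewrite (tlift_tens _ _ counit2_bilinear).
  by rewrite (scalable_linear (l _)) (scalable_linear (r _)) /= scalerA.
rewrite -{2}(counitr c) -{2}(counitr d) (tlift_comp _ _ (l _)).
by apply: eq_tlift => c1 c2; rewrite (tlift_comp _ _ (r _)).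
Qed.

HB.instance Definition _ := Lmodule_isCoalgebra.Build k (tensor C D)
  tensor_coassoc tensor_counitl tensor_counitr.

End TensorCoalgebra.

HB.mixin Record isHopfAlgebra (k : fieldType) H
    of GRing.Algebra k H & Coalgebra k H := {
  comul1 : comul (1 : H) = 1 ⊗ 1;
  comulM : forall x y : H,
    comul (x * y) =
    \sw_(x1, x2 <- x) \sw_(y1, y2 <- y) ((x1 * y1) ⊗ (x2 * y2));
  counit1 : counit (1 : H) = 1;
  counitM : forall x y : H, counit (x * y) = counit x * counit y;
  antipode : {linear H -> H};
  antipodel : forall x : H,
    \sw_(x1, x2 <- x) antipode x1 * x2 = counit x *: 1;
  antipoder : forall x : H,
    \sw_(x1, x2 <- x) x1 * antipode x2 = counit x *: 1
}.

#[short(type="hopfAlgType")]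
HB.structure Definition HopfAlgebra (k : fieldType) :=
  { H of GRing.Algebra k H & Coalgebra k H & isHopfAlgebra k H }.

(* [\sw[n]_(s <- x) E] is sum E(x_(1), ..., x_(n+1)), where the entries of
   s : seq C are x_(1), ..., x_(n+1); the iterated comultiplication
   C -> C^(⊗ n+1) is Delta^n = (id ⊗ Delta^(n-1)) Delta.  E has to be multilinear in s. *)
Fixpoint iter_sw (k : fieldType) (C : coalgType k) (W : nmodType) (n : nat)
    (E : seq C -> W) (x : C) : W :=
  if n is m.+1 then \sw_(a, b <- x) iter_sw m (fun s => E (a :: s)) b
  else E [:: x].

Notation "\sw[ n ]_ ( s <- x ) E" := (iter_sw n (fun s => E) x)
  (at level 41, E at level 41, s name, x at level 50,
   format "\sw[ n ]_ ( s  <-  x )  E") : ring_scope.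

Section HopfQBrace.
Variables (k : fieldType) (H : hopfAlgType k).
Variables dot colon : {linear tensor H H -> H}.

Local Notation "x · y" := (dot (x ⊗ y)) (at level 45, no associativity).
Local Notation "x ⦂ y" := (colon (x ⊗ y)) (at level 45, no associativity).

(* Both Sweedler sums refer to the comultiplication of H, not to that of
   H^cop; the latter only enters through the coalgebras H ⊗ H^cop and
   H^cop ⊗ H, between which this map is required to be a morphism. *)
Definition q_magma_map : tensor H (cop H) -> tensor (cop H) H :=
  tlift (fun x y : H =>
    \sw_(x1, x2 <- x) \sw_(y1, y2 <- y) (((y1 ⦂ x2) : cop H) ⊗ (x1 · y2))).

Record q_magma_coalgebra : Prop := QMagmaCoalgebra {
  counit_dot : forall x y : H, counit (x · y) = counit x * counit y;
  counit_colon : forall x y : H, counit (x ⦂ y) = counit x * counit y;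
  q_magma_mapP : coalgebra_morphism q_magma_map
}.

Definition left_regular_map : tensor H H -> tensor H H :=
  tlift (fun x y : H => \sw_(y1, y2 <- y) ((x · y1) ⊗ y2)).

Definition left_regular : Prop := bijective left_regular_map.

Record q_cycle_coalgebra : Prop := QCycleCoalgebra {
  q_cycle_magma : q_magma_coalgebra;
  q_cycle_left_regular : left_regular;
  q_cycle_dd : forall x y z : H,
    \sw_(y1, y2 <- y) ((x · y1) · (z ⦂ y2)) =
    \sw_(z1, z2 <- z) ((x · z2) · (y · z1));
  q_cycle_cd : forall x y z : H,
    \sw_(y1, y2 <- y) ((x · y1) ⦂ (z · y2)) =
    \sw_(z1, z2 <- z) ((x ⦂ z2) · (y ⦂ z1));
  q_cycle_cc : forall x y z : H,
    \sw_(y1, y2 <- y) ((x ⦂ y1) ⦂ (z ⦂ y2)) =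
    \sw_(z1, z2 <- z) ((x ⦂ z2) ⦂ (y · z1))
}.

(* Right module over H^op, acting on the underlying vector space of H. *)
Definition right_op_module (act : {linear tensor H H -> H}) : Prop :=
  (forall h : H, act (h ⊗ 1) = h) /\
  (forall h a b : H, act (h ⊗ (a * b)) = act (act (h ⊗ b) ⊗ a)).

Record hopf_q_brace : Prop := HopfQBrace {
  q_brace_q_cycle : q_cycle_coalgebra;
  q_brace_dot_module : right_op_module dot;
  q_brace_colon_module : right_op_module colon;
  q_brace_mul_dot : forall h a l : H,
    (h * a) · l =
    \sw_(a1, a2 <- a) \sw_(l1, l2 <- l) (h · (l1 ⦂ a2)) * (a1 · l2);
  q_brace_mul_colon : forall h a l : H,
    (h * a) ⦂ l =
    \sw_(a1, a2 <- a) \sw_(l1, l2 <- l) (h ⦂ (l1 · a2)) * (a1 ⦂ l2)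
}.

End HopfQBrace.

(* The tuple (i_1, ..., i_{j+1}).  With n = j./2, after n + 1 (and 2n + 2 when
   j is odd) the tuple lists m, 2n + 2 - m for m = 1, ..., n. *)
Definition idx_tuple (j : nat) : seq nat :=
  let n := j./2 in
  let tail := flatten [seq [:: m; n.*2.+2 - m]%N | m <- iota 1 n] in
  if odd j then [:: n.+1, n.*2.+2 & tail] else n.+1 :: tail.

Example idx_tupleE : [seq idx_tuple j | j <- iota 1 6] =
  [:: [:: 1; 2]; [:: 2; 1; 3]; [:: 2; 4; 1; 3]; [:: 3; 1; 5; 2; 4];
      [:: 3; 6; 1; 5; 2; 4]; [:: 4; 1; 7; 2; 6; 3; 5]]%N.
Proof. by []. Qed.

(* h_(i_m), where s = [:: h_(1); ...; h_(j+1)]. *)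
Definition leg (V : nmodType) (j : nat) (s : seq V) (m : nat) : V :=
  nth 0 s (nth 0%N (idx_tuple j) m.-1).-1.

(* Main.v *)
Require Import Defs.
From HB Require Import structures.
From mathcomp Require Import all_boot all_algebra.

Set Implicit Arguments.
Unset Strict Implicit.
Unset Printing Implicit Defensive.

Import GRing.Theory.
Local Open Scope ring_scope.

(** The case j = 1 carries the theorem.  On the coalgebra H ⊗ H consider
    Q (h ⊗ l) = S(h) · l and P (h ⊗ l) = h_(1) · (l ⦂ S(h_(2))).  Expanding
    (h_(1) S(h_(2))) · l and (S(h_(1)) h_(2)) · (l ⦂ S(h_(3))) by the product
    rule of the brace, and using 1 · l = ε(l) 1 ([dot1l]), shows that P and Q
    are inverse to each other for convolution.  The operation · reverses the
    legs of its right argument and S those of its own, so Q reverses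
    comultiplication on H ⊗ H; the convolution inverse of such a map preserves
    comultiplication ([comul_conv_inverse]).  So S \o P is a convolution
    inverse of P as well, and Q = S \o P by uniqueness ([dot_antipode]).

    That 1 · l = ε(l) 1 also comes from the convolution algebra: g = 1 · _
    satisfies g(l) = g(l_(1)) g(l_(2)) by the product rule, and
    g(l_(1)) g(l_(2)) = g(l_(2)) g(l_(1)) = g(l)_(1) g(l)_(2) because the
    q-magma map is a coalgebra morphism.  So each c in the image of g is
    c_(1) c_(2), and cancelling with S leaves c = ε(c) 1.

    For larger j, apply the case j = 1 to S^j(h) in S^(j+1)(h) · x =
    S(S^j(h)) · x, and then the formula for j to the left factor
    ([dot_iter_antipode]).  Since S^j preserves the order of the legs of h for
    even j and reverses it for odd j, the leg that this adds, acted on by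
    S^(j+1), is the last one or the first one.  The tuple (i_1, ..., i_(j+1))
    grows in the same way ([idx_tupleS_even], [idx_tupleS_odd]), starting from
    (1) at j = 0.

    The axioms used are invariant under the exchange of · and ⦂, so both
    formulas are instances of one statement about a pair of operations. *)

(** * Linearity of Sweedler expressions *)

Section Lin.
Variables (k : fieldType).
Implicit Types U V W X : lmodType k.

Lemma lin_id V : linear (fun x : V => x). Proof. by []. Qed.

Lemma lin_fun U V W (g : {linear V -> W}) (f : U -> V) :
  linear f -> linear (fun x => g (f x)).
Proof. by move=> Lf a x y; rewrite Lf linearP. Qed.

Lemma lin_tensl U V W (f : U -> V) (w : W) :
  linear f -> linear (fun x => f x ⊗ w).
Proof. by move=> Lf a x y; rewrite Lf (tens_bilinear _ _).1. Qed.

Lemma lin_tensr U V W (f : U -> V) (w : W) :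
  linear f -> linear (fun x => w ⊗ f x).
Proof. by move=> Lf a x y; rewrite Lf (tens_bilinear _ _).2. Qed.

Lemma lin_mull U (A : algType k) (f : U -> A) (b : A) :
  linear f -> linear (fun x => f x * b).
Proof. by move=> Lf a x y; rewrite Lf mulrDl scalerAl. Qed.

Lemma lin_mulr U (A : algType k) (f : U -> A) (b : A) :
  linear f -> linear (fun x => b * f x).
Proof. by move=> Lf a x y; rewrite Lf mulrDr scalerAr. Qed.

Lemma lin_scaler U V (f : U -> V) (c : k) :
  linear f -> linear (fun x => c *: f x).
Proof. by move=> Lf a x y; rewrite Lf scalerDr !scalerA mulrC. Qed.

Lemma lin_counit U (C : coalgType k) V (f : U -> C) (v : V) :
  linear f -> linear (fun x => counit (f x) *: v).
Proof. by move=> Lf a x y; rewrite Lf linearP scalerDl scalerA. Qed.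

Lemma lin_sw U (C : coalgType k) W (f : C -> C -> W) (g : U -> C) :
  (forall b, linear (fun a => f a b)) -> (forall a, linear (f a)) ->
  linear g -> linear (fun x => \sw_(a, b <- g x) f a b).
Proof. by move=> f1 f2 Lg a x y; rewrite Lg sw_linear. Qed.

Lemma lin_tlift U V W X (f : V -> W -> X) (g : U -> tensor V W) :
  (forall b, linear (fun a => f a b)) -> (forall a, linear (f a)) ->
  linear g -> linear (fun x => tlift f (g x)).
Proof. by move=> f1 f2 Lg a x y; rewrite Lg tlift_linear. Qed.

Lemma lin_iter V (g : {linear V -> V}) n : linear (iter n g).
Proof. by elim: n => [|n IH] a x y //=; rewrite IH linearP. Qed.

Lemma lin_iter_fun U V (g : {linear V -> V}) n (f : U -> V) :
  linear f -> linear (fun x => iter n g (f x)).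
Proof. by move=> Lf a x y; rewrite Lf lin_iter. Qed.
End Lin.

(* Extended below to the product of the tensor square of an algebra. *)
Ltac lin_hook := fail.

(** Sweedler sums may be rearranged only when their bodies are multilinear.
    A multilinear expression contains each bound variable once, so linearity in
    a variable is decided by descending along its unique occurrence; the
    pattern variables [?w] and [?t] match only terms free of it, and so select
    the branch. *)
Ltac lin_step :=
  match goal with
  | |- forall _, _ => let x := fresh "t" in intro x; cbv beta
  | |- bilinear_for _ _ _ => split
  | |- trilinear _ => split
  | |- _ => assumption
  | |- GRing.linear_for _ (fun x => x) => exact: lin_id
  | |- GRing.linear_for _ (fun x => tlift (fun a b => _) ?t) => apply: tlift_paramL
  | |- GRing.linear_for _ (fun x => tlift _ _) => first [apply: lin_sw | apply: lin_tlift]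
  | |- GRing.linear_for _ (fun x => tens _ ?w) => apply: lin_tensl
  | |- GRing.linear_for _ (fun x => tens ?w _) => apply: lin_tensr
  | |- GRing.linear_for _ (fun x => GRing.mul _ ?w) => apply: lin_mull
  | |- GRing.linear_for _ (fun x => GRing.mul ?w _) => apply: lin_mulr
  | |- GRing.linear_for _ (fun x => GRing.scale ?w _) => apply: lin_scaler
  | |- GRing.linear_for _ (fun x => GRing.scale (GRing.Linear.sort _ _) _) => apply: lin_counit
  | |- GRing.linear_for _ (fun x => iter _ _ _) => apply: lin_iter_fun
  | |- GRing.linear_for _ (fun x => GRing.Linear.sort _ _) => apply: lin_fun
  | |- _ => lin_hook
  (* An eta-contracted map is expanded so that the patterns above apply. *)
  | |- @GRing.linear_for ?R ?U ?V ?s ?f =>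
      lazymatch f with
      | (fun _ => _) => fail
      | _ => change (@GRing.linear_for R U V s (fun x => f x))
      end
  end; cbv beta.

Ltac lin := repeat lin_step.

(** * Sweedler calculus and the tensor square of an algebra *)

Lemma scaler_tlift (k : fieldType) (U V W : lmodType k) (a : k)
    (f : U -> V -> W) t :
  a *: tlift f t = \tsum_(u, v <- t) (a *: f u v).
Proof. exact: scaler_sumr. Qed.

Section SweedlerCalculus.
Variables (k : fieldType) (C : coalgType k).
Implicit Types W : lmodType k.

Lemma sw_counitl W (f : C -> W) x :
  linear f -> \sw_(a, b <- x) (counit a *: f b) = f x.
Proof.
move=> Lf; rewrite -[in RHS](counitl x) (tlift_comp _ _ Lf).
by apply: eq_tlift => a b; rewrite (scalable_linear Lf).
Qed.

Lemma sw_counitr W (f : C -> W) x :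
  linear f -> \sw_(a, b <- x) (counit b *: f a) = f x.
Proof.
move=> Lf; rewrite -[in RHS](counitr x) (tlift_comp _ _ Lf).
by apply: eq_tlift => a b; rewrite (scalable_linear Lf).
Qed.
End SweedlerCalculus.

Lemma tlift_tensors (k : fieldType) (U V U' V' W : lmodType k)
    (G : U -> V -> W) (f : U' -> V' -> U) (h : U' -> V' -> V) t :
  is_bilinear G ->
  tlift G (\tsum_(a, b <- t) (f a b ⊗ h a b)) = \tsum_(a, b <- t) G (f a b) (h a b).
Proof.
move=> bG; rewrite (tlift_comp _ _ (tlift_linear bG)).
by apply: eq_tlift => a b; rewrite tlift_tens.
Qed.

Lemma sw_id (k : fieldType) (C : coalgType k) (x : C) :
  \sw_(a, b <- x) (a ⊗ b) = comul x.
Proof. exact: (esym (tlift_unique (@lin_id _ _) (fun u v => erefl) _)). Qed.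

Section TensorAlgebra.
Variables (k : fieldType) (A : algType k).

Definition tmul (s t : tensor A A) : tensor A A :=
  \tsum_(a, b <- s) \tsum_(c, d <- t) ((a * c) ⊗ (b * d)).

Lemma lin_tmull (U : lmodType k) (f : U -> tensor A A) t :
  linear f -> linear (fun x => tmul (f x) t).
Proof. by move=> Lf; rewrite /tmul; lin. Qed.

Lemma lin_tmulr (U : lmodType k) (f : U -> tensor A A) s :
  linear f -> linear (fun x => tmul s (f x)).
Proof. by move=> Lf; rewrite /tmul; lin. Qed.

Lemma tmulE a b c d : tmul (a ⊗ b) (c ⊗ d) = (a * c) ⊗ (b * d).
Proof. by rewrite /tmul !tlift_tens //; lin. Qed.
End TensorAlgebra.

Ltac lin_hook ::=
  match goal with
  | |- GRing.linear_for _ (fun x => tmul _ ?t) => apply: lin_tmull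
  | |- GRing.linear_for _ (fun x => tmul ?s _) => apply: lin_tmulr
  end.

Section TensorAlgebraTheory.
Variables (k : fieldType) (A : algType k).
Implicit Types s : tensor A A.

Lemma tmulA : associative (@tmul k A).
Proof.
move=> r s t.
move: r; apply: tens_ext => [||a a']; try by lin.
move: s; apply: tens_ext => [||b b']; try by lin.
move: t; apply: tens_ext => [||c c']; try by lin.
by rewrite !tmulE !mulrA.
Qed.

Lemma tmul1 s : tmul (1 ⊗ 1) s = s.
Proof.
move: s; apply: tens_ext => [||a a'] //; first by apply: lin_tmulr; lin.
by rewrite tmulE !mul1r.
Qed.

Lemma tmulr1 s : tmul s (1 ⊗ 1) = s.
Proof.
move: s; apply: tens_ext => [||a a'] //; first by apply: lin_tmull; lin.
by rewrite tmulE !mulr1.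
Qed.
End TensorAlgebraTheory.

(** * Convolution inverses *)

Section ConvolutionInverse.
Variables (k : fieldType) (C : coalgType k) (H : hopfAlgType k).

Definition conv_cancel (P Q : C -> H) : Prop :=
  forall x, \sw_(a, b <- x) (P a * Q b) = counit x *: 1.

Lemma conv_inverse_unique (Q P R : {linear C -> H}) :
  conv_cancel Q P -> conv_cancel P R -> Q =1 R.
Proof.
move=> QP PR x.
rewrite -(sw_counitr x (linearP Q)).
transitivity (\sw_(a, b <- x) \sw_(b1, b2 <- b) (Q a * (P b1 * R b2))).
  apply: eq_tlift => a b.
  rewrite -(tlift_comp (fun c e => P c * R e) (g := fun z => Q a * z)); last by lin.
  by rewrite PR -scalerAr mulr1.
rewrite -coassocE; last by lin.
rewrite -[RHS](sw_counitl x (linearP R)); apply: eq_tlift => a b.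
under eq_tlift => a1 a2 do rewrite mulrA.
rewrite -(tlift_comp (fun c e => Q c * P e) (g := fun z => z * R b)); last by lin.
by rewrite QP -scalerAl mul1r.
Qed.

(* The argument is needed for maps that reverse comultiplication and for maps
   that preserve it; taking t to be the identity or the flip covers both. *)
Variable t : {linear tensor H H -> tensor H H}.
Hypothesis tM : forall a b c d,
  tmul (t (a ⊗ b)) (t (c ⊗ d)) = t ((a * c) ⊗ (b * d)).
Hypothesis t1 : t (1 ⊗ 1) = 1 ⊗ 1.

(** Comultiplication is an algebra map, so Δ \o P is a right convolution inverse
    of Δ \o Q in Hom(C, H ⊗ H).  The map R(x) = t(P(x_(1)) ⊗ P(x_(2))) is a
    left inverse: in R(x_(1)) Δ(Q(x_(2))) the reversal makes the inner legs of
    x meet and cancel, and then the outer ones.  Hence the two agree. *)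
Lemma comul_conv_inverse (P Q : {linear C -> H}) :
  conv_cancel P Q -> conv_cancel Q P ->
  (forall x, comul (Q x) = \sw_(a, b <- x) t (Q b ⊗ Q a)) ->
  forall x, comul (P x) = \sw_(a, b <- x) t (P a ⊗ P b).
Proof.
move=> PQ QP comulQ x.
pose R y := \sw_(a, b <- y) t (P a ⊗ P b).
have LR : linear R by rewrite /R; lin.
have RQ y : \sw_(a, b <- y) tmul (R a) (comul (Q b)) = counit y *: (1 ⊗ 1).
  transitivity (\sw_(a, b <- y) \sw_(a1, a2 <- a) \sw_(b1, b2 <- b)
      t ((P a1 * Q b2) ⊗ (P a2 * Q b1))).
    apply: eq_tlift => a b; rewrite comulQ /R.
    rewrite (tlift_comp _ _ (g := fun z => tmul z _)); last by lin.
    apply: eq_tlift => a1 a2.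
    rewrite (tlift_comp _ _ (g := tmul _)); last by lin.
    by apply: eq_tlift => b1 b2; rewrite tM.
  rewrite coassocE; last by lin.
  transitivity (\sw_(a, b <- y) t ((P a * Q b) ⊗ 1)).
    apply: eq_tlift => a b; rewrite -coassocE; last by lin.
    rewrite -(sw_counitl b (f := fun z => t ((P a * Q z) ⊗ 1))); last by lin.
    apply: eq_tlift => c d.
    rewrite -(tlift_comp (fun u v => P u * Q v) (g := fun z => t ((P a * Q d) ⊗ z))); last by lin.
    rewrite PQ; apply: (scalable_linear (f := fun z => t (_ ⊗ z))); lin.
  rewrite -(tlift_comp (fun u v => P u * Q v) (g := fun z => t (z ⊗ 1))); last by lin.
  rewrite PQ -t1; apply: (scalable_linear (f := fun z => t (z ⊗ 1))); lin.
(* In the convolution algebra, R = R * (ΔQ * ΔP) = (R * ΔQ) * ΔP = ΔP. *)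
rewrite -/(R x) -(sw_counitr x LR); symmetry.
transitivity (\sw_(a, b <- x) \sw_(b1, b2 <- b)
    tmul (R a) (tmul (comul (Q b1)) (comul (P b2)))).
  apply: eq_tlift => a b.
  transitivity (tmul (R a) (comul (counit b *: (1 : H)))).
    by rewrite linearZ /= comul1 (scalable_linear (lin_tmulr (R a) (@lin_id _ _))) tmulr1.
  rewrite -QP (tlift_comp _ _ (g := fun z => tmul (R a) (comul z))); last by lin.
  by apply: eq_tlift => b1 b2; rewrite comulM.
rewrite -coassocE; last by lin.
rewrite -[RHS](sw_counitl x (f := fun z => comul (P z))); last by lin.
apply: eq_tlift => a b.
under eq_tlift => a1 a2 do rewrite tmulA.
rewrite -(tlift_comp (fun u v => tmul (R u) (comul (Q v))) (g := fun z => tmul z (comul (P b)))); last by lin.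
by rewrite RQ (scalable_linear (lin_tmull (comul (P b)) (@lin_id _ _))) tmul1.
Qed.
End ConvolutionInverse.

(** * The antipode reverses comultiplication *)

Section Antipode.
Variables (k : fieldType) (H : hopfAlgType k).

Lemma counit_antipode (x : H) : counit (antipode x) = counit x.
Proof.
have L : linear (fun z : H => counit z : k^o) by lin.
have := congr1 (fun z : H => counit z : k^o) (antipodel x).
rewrite (tlift_comp _ _ L) (scalable_linear L) /= counit1 [_ *: _]mulr1 => <-.
have L' : linear (fun z : H => counit (antipode z) : k^o) by lin.
rewrite -[LHS](sw_counitr x L').
by apply: eq_tlift => a b; rewrite counitM; exact: mulrC.
Qed.

Definition tswap : {linear tensor H H -> tensor H H} :=
  mklinear (tlift_linear (bilinear_flip (@tens_bilinear k H H))).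

Lemma tswapE (a b : H) : tswap (a ⊗ b) = b ⊗ a.
Proof. by apply: tlift_tens; lin. Qed.

(** The antipode is the convolution inverse of the identity, which preserves
    comultiplication. *)
Lemma comul_antipode (x : H) :
  comul (antipode x) = \sw_(a, b <- x) (antipode b ⊗ antipode a).
Proof.
rewrite (@comul_conv_inverse k H H tswap _ _ antipode idfun).
- by apply: eq_tlift => a b; rewrite tswapE.
- by move=> a b c d; rewrite !tswapE tmulE.
- by rewrite tswapE.
- exact: antipodel.
- exact: antipoder.
move=> y; transitivity (comul y) => //; rewrite -{1}sw_id.
by apply: eq_tlift => a b; rewrite [RHS]tswapE.
Qed.
End Antipode.

(** * The coalgebra structure of the two operations *)

Section TensScale.
Variables (k : fieldType) (U V : lmodType k).

Lemma tensZl (a : k) (u : U) (v : V) : (a *: u) ⊗ v = a *: (u ⊗ v).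
Proof. by rewrite (scalable_linear (lin_tensl v (@lin_id _ _))). Qed.

Lemma tensZr (a : k) (u : U) (v : V) : u ⊗ (a *: v) = a *: (u ⊗ v).
Proof. by rewrite (scalable_linear (lin_tensr u (@lin_id _ _))). Qed.
End TensScale.

Section TensorProjections.
Variables (k : fieldType) (C D : coalgType k).

Fact tpr1_bilinear : is_bilinear (fun (x : C) (y : D) => counit y *: x).
Proof. by lin. Qed.

Fact tpr2_bilinear : is_bilinear (fun (x : C) (y : D) => counit x *: y).
Proof. by lin. Qed.

Definition tpr1 : {linear tensor C D -> C} := mklinear (tlift_linear tpr1_bilinear).
Definition tpr2 : {linear tensor C D -> D} := mklinear (tlift_linear tpr2_bilinear).

Lemma tpr1E c d : tpr1 (c ⊗ d) = counit d *: c.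
Proof. exact: tlift_tens tpr1_bilinear. Qed.

Lemma tpr2E c d : tpr2 (c ⊗ d) = counit c *: d.
Proof. exact: tlift_tens tpr2_bilinear. Qed.

Lemma sw_tens (W : lmodType k) (G : tensor C D -> tensor C D -> W) c d :
  is_bilinear G ->
  \sw_(u, v <- c ⊗ d) G u v =
  \sw_(c1, c2 <- c) \sw_(d1, d2 <- d) G (c1 ⊗ d1) (c2 ⊗ d2).
Proof. exact: tlift_tensor_comul. Qed.
End TensorProjections.

Arguments tpr1 {k C D}.
Arguments tpr2 {k C D}.

Section TensorProjectionsTheory.
Variables (k : fieldType) (C D : coalgType k).
Implicit Type z : tensor C D.

Lemma comul_tpr1 z : comul (tpr1 z) = \sw_(u, v <- z) (tpr1 u ⊗ tpr1 v).
Proof.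
move: z; apply: tens_ext => [||c d]; try by lin.
rewrite sw_tens; last by lin.
rewrite tpr1E linearZ_LR -{1}sw_id scaler_tlift.
apply: eq_tlift => c1 c2; rewrite -tensZr.
rewrite -(sw_counitl d (f := fun e => c1 ⊗ (counit e *: c2))); last by lin.
by apply: eq_tlift => d1 d2; rewrite !tpr1E tensZl.
Qed.

Lemma comul_tpr2 z : comul (tpr2 z) = \sw_(u, v <- z) (tpr2 u ⊗ tpr2 v).
Proof.
move: z; apply: tens_ext => [||c d]; try by lin.
rewrite sw_tens; last by lin.
rewrite tpr2E linearZ_LR -{1}sw_id tlift_exchange.
rewrite scaler_tlift.
apply: eq_tlift => d1 d2; rewrite -tensZr.
rewrite -(sw_counitl c (f := fun e => d1 ⊗ (counit e *: d2))); last by lin.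
by apply: eq_tlift => c1 c2; rewrite !tpr2E tensZl.
Qed.

(** On c ⊗ d the two projections apply the counit to one leg of c and to one leg
    of d. *)
Lemma sw_tpr z : \sw_(u, v <- z) (tpr1 u ⊗ tpr2 v) = z.
Proof.
move: z; apply: tens_ext => [||c d]; try by lin.
rewrite sw_tens; last by lin.
rewrite -[RHS](sw_counitr c (f := fun e => e ⊗ d)); last by lin.
apply: eq_tlift => c1 c2.
rewrite -(sw_counitl d (f := fun e => c1 ⊗ e)); last by lin.
rewrite scaler_tlift.
by apply: eq_tlift => d1 d2; rewrite tpr1E tpr2E tensZl tensZr scalerA mulrC -scalerA.
Qed.

End TensorProjectionsTheory.

Section QMagma.
Variables (k : fieldType) (H : hopfAlgType k).
Variables dot colon : {linear tensor H H -> H}.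
Local Notation "x · y" := (dot (x ⊗ y)) (at level 45, no associativity).
Local Notation "x ⦂ y" := (colon (x ⊗ y)) (at level 45, no associativity).
Hypothesis qmag : q_magma_coalgebra dot colon.

Local Notation q := (q_magma_map dot colon).

Let q_linear : linear q.
Proof. by case: (q_magma_mapP qmag). Qed.

Lemma q_magma_mapE (x y : H) :
  q ((x : H) ⊗ (y : cop H)) =
  \sw_(x1, x2 <- x) \sw_(y1, y2 <- y) (((y1 ⦂ x2) : cop H) ⊗ (x1 · y2)).
Proof. by apply: tlift_tens; lin. Qed.

(** The two marginals of the q-magma map are the operations themselves
    ([tpr2_q] is the other one), so that its compatibility with comultiplication
    splits into one identity for each operation and one that links them. *)
Lemma tpr1_q (x y : H) : tpr1 (q ((x : H) ⊗ (y : cop H))) = y ⦂ x.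
Proof.
rewrite q_magma_mapE (tlift_comp _ _ (linearP tpr1)).
rewrite -[RHS](sw_counitl x (f := fun z => y ⦂ z)); last by lin.
apply: eq_tlift => x1 x2; rewrite (tlift_comp _ _ (linearP tpr1)).
rewrite -[in RHS](sw_counitr y (f := fun z => z ⦂ x2)); last by lin.
rewrite scaler_tlift.
apply: eq_tlift => y1 y2.
by rewrite tpr1E (counit_dot qmag) scalerA.
Qed.

Lemma tpr2_q (x y : H) : tpr2 (q ((x : H) ⊗ (y : cop H))) = x · y.
Proof.
rewrite q_magma_mapE (tlift_comp _ _ (linearP tpr2)).
rewrite -[RHS](sw_counitr x (f := fun z => z · y)); last by lin.
apply: eq_tlift => x1 x2; rewrite (tlift_comp _ _ (linearP tpr2)).
rewrite -[in RHS](sw_counitl y (f := fun z => x1 · z)); last by lin.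
rewrite scaler_tlift.
apply: eq_tlift => y1 y2.
rewrite tpr2E [counit _](counit_colon qmag) scalerA.
by congr (_ *: _); exact: mulrC.
Qed.

Lemma sw_q (W : lmodType k) (G : tensor (cop H) H -> tensor (cop H) H -> W)
    (x y : H) :
  is_bilinear G ->
  \sw_(u, v <- q ((x : H) ⊗ (y : cop H))) G u v =
  \sw_(x1, x2 <- x) \sw_(y1, y2 <- y)
     G (q ((x1 : H) ⊗ (y2 : cop H))) (q ((x2 : H) ⊗ (y1 : cop H))).
Proof.
move=> bG; case: (q_magma_mapP qmag) => _ -> _.
rewrite (tlift_comp _ _ (tlift_linear bG)).
under eq_tlift => u v do rewrite tlift_tens //.
rewrite sw_tens; last by case: bG => G1 G2; split=> ? a u v /=; rewrite q_linear ?G1 ?G2.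
apply: eq_tlift => x1 x2; rewrite tlift_cop //.
case: bG => G1 G2; split=> ? a u v /=; rewrite !(tens_bilinear _ _).2 q_linear ?G1 ?G2 //.
Qed.

Lemma comul_dot (x y : H) :
  comul (x · y) =
  \sw_(x1, x2 <- x) \sw_(y1, y2 <- y) ((x1 · y2) ⊗ (x2 · y1)).
Proof.
rewrite -tpr2_q comul_tpr2 sw_q; last by lin.
by apply: eq_tlift => x1 x2; apply: eq_tlift => y1 y2; rewrite !tpr2_q.
Qed.

Lemma comul_colon (x y : H) :
  comul (x ⦂ y) =
  \sw_(x1, x2 <- x) \sw_(y1, y2 <- y) ((x1 ⦂ y2) ⊗ (x2 ⦂ y1)).
Proof.
(* The first marginal lives in H^cop, whence the flip back to H. *)
have E := comul_tpr1 (q ((y : H) ⊗ (x : cop H))).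
rewrite tpr1_q sw_q in E; last by lin.
pose swap (t : tensor (cop H) (cop H)) : tensor H H :=
  \tsum_(a, b <- t) ((b : H) ⊗ (a : H)).
have Lswap : linear swap by rewrite /swap; lin.
rewrite -(sw_id (x ⦂ y)).
transitivity (swap (cop_comul (x ⦂ y))).
  by rewrite /swap tlift_cop //; lin.
transitivity (swap (\sw_(x1, x2 <- y) \sw_(y1, y2 <- x)
   (tpr1 (q ((x1 : H) ⊗ (y2 : cop H))) ⊗ tpr1 (q ((x2 : H) ⊗ (y1 : cop H)))))).
  by congr swap.
rewrite (tlift_comp _ _ Lswap) [RHS]tlift_exchange.
apply: eq_tlift => y1 y2; rewrite (tlift_comp _ _ Lswap).
apply: eq_tlift => x1 x2; rewrite !tpr1_q /swap.
by apply: tlift_tens; lin.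
Qed.

(** Reassembling the marginals of the two legs of q(x ⊗ y) gives q(x ⊗ y)
    back, but with the legs of x and y exchanged with respect to the
    definition of q. *)
Lemma dot_colon_compat (x y : H) :
  \sw_(x1, x2 <- x) \sw_(y1, y2 <- y) ((y2 ⦂ x1) ⊗ (x2 · y1)) =
  \sw_(x1, x2 <- x) \sw_(y1, y2 <- y) ((y1 ⦂ x2) ⊗ (x1 · y2)).
Proof.
transitivity (q ((x : H) ⊗ (y : cop H))); last exact: q_magma_mapE.
rewrite -(sw_tpr (q _)) sw_q; last by lin.
by apply: eq_tlift => x1 x2; apply: eq_tlift => y1 y2; rewrite tpr1_q tpr2_q.
Qed.
End QMagma.

(** * The antipode in the left argument of an operation *)

Section HalfBrace.
Variables (k : fieldType) (H : hopfAlgType k).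
Variables d c : {linear tensor H H -> H}.
Local Notation "x · y" := (d (x ⊗ y)) (at level 45, no associativity).
Local Notation "x ⦂ y" := (c (x ⊗ y)) (at level 45, no associativity).

Lemma sw1 (W : lmodType k) (f : H -> H -> W) :
  is_bilinear f -> \sw_(a, b <- 1) f a b = f 1 1.
Proof. by move=> bf; rewrite comul1 tlift_tens. Qed.

(* The properties of (·, ⦂) that are shared by (⦂, ·). *)
Hypothesis counit_d : forall x y, counit (x · y) = counit x * counit y.
Hypothesis counit_c : forall x y, counit (x ⦂ y) = counit x * counit y.
Hypothesis comul_d : forall x y, comul (x · y) =
  \sw_(x1, x2 <- x) \sw_(y1, y2 <- y) ((x1 · y2) ⊗ (x2 · y1)).
Hypothesis comul_c : forall x y, comul (x ⦂ y) =
  \sw_(x1, x2 <- x) \sw_(y1, y2 <- y) ((x1 ⦂ y2) ⊗ (x2 ⦂ y1)).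
Hypothesis compat1 : forall x,
  \sw_(x1, x2 <- x) (x1 ⊗ (1 · x2)) = \sw_(x1, x2 <- x) (x2 ⊗ (1 · x1)).
Hypothesis c1 : forall x, x ⦂ 1 = x.
Hypothesis cM : forall x a b, x ⦂ (a * b) = (x ⦂ b) ⦂ a.
Hypothesis mul_d : forall h a l, (h * a) · l =
  \sw_(a1, a2 <- a) \sw_(l1, l2 <- l) (h · (l1 ⦂ a2)) * (a1 · l2).

Local Notation g x := (1 · x).

Let comul_g x : comul (g x) = \sw_(x1, x2 <- x) (g x2 ⊗ g x1).
Proof. by rewrite comul_d sw1 //; lin. Qed.

Let g_mul x : g x = \sw_(x1, x2 <- x) (g x1 * g x2).
Proof.
rewrite -{1}[1](mul1r (1 : H)) mul_d sw1; last by lin.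
by apply: eq_tlift => x1 x2; rewrite c1.
Qed.

(** The relation [compat1] exchanges the two factors of [g_mul], and in the new
    order they are the two legs of g(x). *)
Let g_idem x : g x = \sw_(a, b <- g x) (a * b).
Proof.
have := congr1 (tlift (fun a b => g a * b)) (compat1 x).
by rewrite comul_g g_mul !tlift_tensors; try lin.
Qed.

(** In the convolution algebra the inclusion of the image of g is idempotent and
    has the antipode as inverse, so it equals the unit. *)
Lemma dot1l x : 1 · x = counit x *: 1.
Proof.
transitivity (\sw_(a, b <- g x) (antipode a * b)); last first.
  by rewrite antipodel counit_d counit1 mul1r.
transitivity (\sw_(a, b <- g x) \sw_(b1, b2 <- b) (antipode a * (b1 * b2))).
  rewrite -coassocE; last by lin.
  rewrite -[LHS](sw_counitl (g x) (f := fun z => z)); last by lin.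
  apply: eq_tlift => a b.
  under eq_tlift => a1 a2 do rewrite mulrA.
  rewrite -(tlift_comp (fun u v => antipode u * v) (g := fun z => z * b)); last by lin.
  by rewrite antipodel -scalerAl mul1r.
rewrite !comul_g !tlift_tensors; try by lin.
apply: eq_tlift => x1 x2.
rewrite -(tlift_comp (fun u v => u * v) (g := fun z => antipode (g x2) * z)); last by lin.
by rewrite -g_idem.
Qed.

Let P0 h l := \sw_(a, b <- h) (a · (l ⦂ antipode b)).
Let Q0 h l := antipode h · l.
Let P0_bilinear : is_bilinear P0. Proof. by rewrite /P0; lin. Qed.
Let Q0_bilinear : is_bilinear Q0. Proof. by rewrite /Q0; lin. Qed.
Let P : {linear tensor H H -> H} := mklinear (tlift_linear P0_bilinear).
Let Q : {linear tensor H H -> H} := mklinear (tlift_linear Q0_bilinear).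
Let PE h l : P (h ⊗ l) = \sw_(a, b <- h) (a · (l ⦂ antipode b)).
Proof. exact: tlift_tens. Qed.
Let QE h l : Q (h ⊗ l) = antipode h · l.
Proof. exact: tlift_tens. Qed.

Let counit2E (h l : H) : counit (h ⊗ l) = counit h * counit l.
Proof. exact: (tlift_tens _ _ (@counit2_bilinear _ _ _)). Qed.

(** This is (h_(1) S(h_(2))) · l = ε(h) ε(l) 1, expanded by the product rule. *)
Let PQ : conv_cancel P Q.
Proof.
rewrite /conv_cancel; apply: tens_ext => [||h l]; try by lin.
rewrite sw_tens; last by lin.
rewrite counit2E -scalerA -dot1l.
transitivity ((counit h *: 1) · l); last first.
  by rewrite tensZl linearZ.
rewrite -antipoder (tlift_comp _ _ (g := fun z => z · l)); last by lin.
transitivity (\sw_(a, b <- h) \sw_(b1, b2 <- b) \sw_(l1, l2 <- l)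
    (a · (l1 ⦂ antipode b1)) * (antipode b2 · l2)).
  rewrite -coassocE; last by lin.
  apply: eq_tlift => a b; rewrite [RHS]tlift_exchange.
  apply: eq_tlift => l1 l2; rewrite PE QE.
  by rewrite (tlift_comp _ _ (g := fun z => z * _)) //; lin.
apply: eq_tlift => a b; rewrite mul_d comul_antipode.
by rewrite tlift_tensors //; lin.
Qed.

(** Expand (S(u_(1)) u_(2)) · y = ε(u) ε(y) 1 by the product rule ([E]) and put
    u = h_(1), y = l ⦂ S(h_(2)).  In the first factor l_(1) is then acted on by
    S(v1) and by b2, that is by b2 S(v1) as ⦂ is a right H^op-action; b2 and v1
    are adjacent legs of h, so they cancel. *)
Let QP : conv_cancel Q P.
Proof.
rewrite /conv_cancel; apply: tens_ext => [||h l]; try by lin.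
rewrite sw_tens; last by lin.
rewrite counit2E.
have E u y : \sw_(a, b <- u) \sw_(b1, b2 <- b) \sw_(y1, y2 <- y)
   (antipode a · (y1 ⦂ b2)) * (b1 · y2) = counit u *: (counit y *: 1).
  rewrite -dot1l -[in RHS]linearZ /= -tensZl -antipodel.
  rewrite (tlift_comp _ _ (g := fun z => z · y)); last by lin.
  by apply: eq_tlift => a b; rewrite mul_d.
(* The common value ε(h) ε(l) 1, written as the sum over h of the right sides
   of [E]. *)
transitivity (\sw_(u, v <- h) (counit u *: (counit (l ⦂ antipode v) *: (1 : H)))); last first.
  rewrite (sw_counitl h (f := fun v => counit (l ⦂ antipode v) *: (1 : H))); last by lin.
  by rewrite counit_c counit_antipode mulrC.
under [RHS]eq_tlift => u v do rewrite -E.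
transitivity (\sw_(u, v <- h) \sw_(a, b <- u) \sw_(b1, b2 <- b)
    \sw_(v1, v2 <- v) \sw_(l1, l2 <- l)
   ((antipode a · ((l1 ⦂ antipode v1) ⦂ b2)) * (b1 · (l2 ⦂ antipode v2)))); last first.
  apply: eq_tlift => u v; apply: eq_tlift => a b; apply: eq_tlift => b1 b2.
  rewrite comul_c comul_antipode [RHS](tlift_comp _ _ (tlift_linear _)); last by lin.
  rewrite [LHS]tlift_exchange; apply: eq_tlift => l1 l2.
  rewrite [in RHS]tlift_tensors; last by lin.
  rewrite (tlift_comp _ _ (tlift_linear _)); last by lin.
  by apply: eq_tlift => v1 v2; rewrite tlift_tens //; lin.
(* Three uses of coassociativity bring b2 and v1 under one comultiplication. *)
rewrite coassocE; last by lin.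
transitivity (\sw_(a, b <- h) \sw_(l1, l2 <- l) \sw_(b1, b2 <- b)
   ((antipode a · l1) * (b1 · (l2 ⦂ antipode b2)))).
  apply: eq_tlift => a b; apply: eq_tlift => l1 l2; rewrite QE PE.
  by rewrite (tlift_comp _ _ (g := fun z => _ * z)) //; lin.
apply: eq_tlift => a r; rewrite tlift_exchange.
transitivity (\sw_(b1, s <- r) \sw_(b2, v <- s) \sw_(v1, v2 <- v)
    \sw_(l1, l2 <- l)
   ((antipode a · ((l1 ⦂ antipode v1) ⦂ b2)) * (b1 · (l2 ⦂ antipode v2)))); last first.
  by rewrite -coassocE //; lin.
apply: eq_tlift => b1 s; rewrite -coassocE; last by lin.
rewrite -(sw_counitl s (f := fun z => \sw_(l1, l2 <- l) (antipode a · l1) * (b1 · (l2 ⦂ antipode z)))); last by lin.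
apply: eq_tlift => w v2; rewrite [RHS]tlift_exchange.
rewrite scaler_tlift.
apply: eq_tlift => l1 l2.
under [RHS]eq_tlift => a1 a2 do rewrite -cM.
rewrite -(tlift_comp (fun u v => u * antipode v) (g := fun z => (antipode a · (l1 ⦂ z)) * _)); last by lin.
rewrite antipoder tensZr !linearZ /= tensZr linearZ /= c1.
by rewrite scalerAl.
Qed.

Let comul_Q z : comul (Q z) = \sw_(u, v <- z) (Q v ⊗ Q u).
Proof.
move: z; apply: tens_ext => [||h l]; try by lin.
rewrite sw_tens; last by lin.
rewrite QE comul_d comul_antipode tlift_tensors; last by lin.
by apply: eq_tlift => h1 h2; apply: eq_tlift => l1 l2; rewrite !QE.
Qed.

Let comul_P z : comul (P z) = \sw_(u, v <- z) (P u ⊗ P v).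
Proof.
apply: (@comul_conv_inverse k (tensor H H) H idfun _ _ P Q) => //.
by move=> a b a' b'; exact: tmulE.
Qed.

Let counit_P z : counit (P z) = counit z.
Proof.
have L : linear (fun z => counit (P z) : k^o) by lin.
have L' : linear (fun z : tensor H H => counit z : k^o) by lin.
move: z; apply: (tens_ext L L') => h l.
rewrite PE counit2E (tlift_comp _ _ (g := fun z : H => counit z : k^o)); last by lin.
have Ll : linear (fun z : H => counit z * counit l : k^o).
  by move=> a x y; rewrite linearP mulrDl -mulrA.
rewrite -(sw_counitr h Ll); apply: eq_tlift => a b.
by rewrite counit_d counit_c counit_antipode mulrA mulrC.
Qed.

(** As P preserves comultiplication, S \o P is a right convolution inverse of P,
    and Q is a left one. *)
Lemma dot_antipode h l :
  antipode h · l = antipode (\sw_(a, b <- h) (a · (l ⦂ antipode b))).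
Proof.
rewrite -QE -PE.
apply: (conv_inverse_unique (R := antipode \o P) QP) => z.
rewrite -(counit_P z) -antipoder comul_P.
by rewrite tlift_tensors //; lin.
Qed.
End HalfBrace.

(** * Iterated comultiplication *)

Section IteratedSweedler.
Variables (k : fieldType) (C : coalgType k).
Implicit Types U W : lmodType k.

(** The argument of E has n + 1 entries: n besides the one that varies.  This is
    the indexing of [iter_sw], where n counts comultiplications. *)
Definition multilinear W (n : nat) (E : seq C -> W) : Prop :=
  forall s t, (size s + size t = n)%N -> linear (fun x => E (s ++ x :: t)).

Lemma eq_iter_sw W n (E F : seq C -> W) x :
  (forall s, size s = n.+1 -> E s = F s) -> iter_sw n E x = iter_sw n F x.
Proof.
elim: n E F x => [|n IH] E F x EF /=; first exact: EF.
by apply: eq_tlift => a b; apply: IH => s ss; apply: EF; rewrite /= ss.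
Qed.

Lemma iter_sw_comp W W' n (E : seq C -> W) (g : {linear W -> W'}) x :
  g (iter_sw n E x) = iter_sw n (g \o E) x.
Proof.
elim: n E x => [|n IH] E x //=.
by rewrite (tlift_comp _ _ (linearP g)); apply: eq_tlift => a b; exact: IH.
Qed.

Lemma iter_sw_param U W n (E : U -> seq C -> W) x :
  (forall s, size s = n.+1 -> linear (fun u => E u s)) ->
  linear (fun u => iter_sw n (E u) x).
Proof.
elim: n E x => [|n IH] E x LE /=; first exact: LE.
apply: tlift_paramL => a b; apply: (IH (fun u s => E u (a :: s))) => s ss.
by apply: LE; rewrite /= ss.
Qed.

Lemma multilinear_cons W n (E : seq C -> W) a :
  multilinear n.+1 E -> multilinear n (fun s => E (a :: s)).
Proof. by move=> mE s t st; apply: (mE (a :: s) t); rewrite /= addSn st. Qed.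

Lemma multilinear_rcons W n (E : seq C -> W) b :
  multilinear n.+1 E -> multilinear n (fun s => E (rcons s b)).
Proof.
move=> mE s t st a x y; rewrite !rcons_cat /=.
by apply: (mE s (rcons t b)); rewrite size_rcons addnS st.
Qed.

Lemma multilinear_head W n (E : seq C -> W) s :
  multilinear n E -> size s = n -> linear (fun a => E (a :: s)).
Proof. by move=> mE ss; apply: (mE [::] s). Qed.

Lemma multilinear_last W n (E : seq C -> W) s :
  multilinear n E -> size s = n -> linear (fun b => E (rcons s b)).
Proof.
move=> mE ss a x y; rewrite -!cats1.
by apply: (mE s [::]); rewrite addn0.
Qed.

Lemma iter_sw_linear W n (E : seq C -> W) :
  multilinear n E -> linear (iter_sw n E).
Proof.
elim: n E => [|n IH] E mE /=; first exact: (mE [::] [::]).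
apply: sw_linear; split=> [b | a].
- apply: (iter_sw_param (E := fun a s => E (a :: s))) => s ss.
  exact: multilinear_head mE ss.
- exact: IH (multilinear_cons a mE).
Qed.

(** [iter_sw] peels legs off the left end by definition; coassociativity allows
    peeling them off the right end, as an induction from even j requires. *)
Lemma iter_sw_rcons W n (E : seq C -> W) x :
  multilinear n.+1 E ->
  iter_sw n.+1 E x = \sw_(a, b <- x) \sw[n]_(s <- a) E (rcons s b).
Proof.
elim: n E x => [|n IH] E x mE //.
transitivity (\sw_(a, b <- x) \sw_(b1, b2 <- b)
                \sw[n]_(s <- b1) E (a :: rcons s b2)).
  by apply: eq_tlift => a b; exact: (IH _ _ (multilinear_cons a mE)).
rewrite -(coassocE (f := fun a b1 b2 => \sw[n]_(s <- b1) E (a :: rcons s b2))) //.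
split=> [b c | a c | a b].
- apply: (iter_sw_param (E := fun a s => E (a :: rcons s c))) => s ss.
  by apply: (multilinear_head (s := rcons s c) mE); rewrite size_rcons ss.
- exact: iter_sw_linear (multilinear_rcons c (multilinear_cons a mE)).
- apply: (iter_sw_param (E := fun c s => E (a :: rcons s c))) => s ss.
  exact: (multilinear_last (multilinear_cons a mE) ss).
Qed.
End IteratedSweedler.

(** * The index tuple *)

Section IndexTuple.

(** The two recursions below match the induction step of the theorem: after
    i_1, the new index is j + 2 (a leg added at the right end) when j is even,
    and 1 (a leg added at the left end, shifting all other indices) when j is
    odd. *)
Lemma idx_tupleS_even j : ~~ odd j ->
  idx_tuple j.+1 = [:: head 0%N (idx_tuple j), j.+2 & behead (idx_tuple j)].
Proof.
move=> ej; rewrite /idx_tuple /= ej (negbTE ej) uphalf_half (negbTE ej) add0n /=.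
congr [:: _, _ & _]; congr _.+2.
by rewrite -[RHS]odd_double_half (negbTE ej).
Qed.

Lemma idx_tupleS_odd j : odd j ->
  idx_tuple j.+1 =
  [:: (head 0%N (idx_tuple j)).+1, 1%N & map S (behead (idx_tuple j))].
Proof.
move=> oj; rewrite /idx_tuple /= oj /= uphalf_half oj add1n /=.
congr [:: _, _, _ & _]; rewrite (iotaDl 1 1) -map_comp map_flatten -map_comp.
congr flatten; apply/eq_in_map => m; rewrite mem_iota add1n ltnS => /andP[_ mn] /=.
by rewrite add1n doubleS subSS subSn // -addnn -addnS -addnS (leq_trans mn) ?leq_addr.
Qed.

Lemma size_idx_tuple j : size (idx_tuple j) = j.+1.
Proof.
elim: j => [|j IH] //; case oj: (odd j).
- by rewrite idx_tupleS_odd //= size_map size_behead IH.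
- by rewrite idx_tupleS_even ?oj //= size_behead IH.
Qed.

Lemma idx_tuple_bound j : all (fun i => 0 < i <= j.+1)%N (idx_tuple j).
Proof.
elim: j => [|j IH] //.
have : idx_tuple j = head 0%N (idx_tuple j) :: behead (idx_tuple j).
  by case: (idx_tuple j) (size_idx_tuple j).
move=> E; move: IH; rewrite E /= => /andP[/andP[h1 h2] /allP ht].
case oj: (odd j).
- rewrite idx_tupleS_odd //= ltnS h2 /= all_map; apply/allP => i /ht /= /andP[_].
  by rewrite ltnS.
- rewrite idx_tupleS_even ?oj //= h1 ltnW ?ltnS //= leqnn /=.
  by apply/allP => i /ht /andP[-> /= ?]; apply: leqW.
Qed.

Lemma idx_tuple_nth j m : (m <= j)%N -> (0 < nth 0%N (idx_tuple j) m <= j.+1)%N.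
Proof.
by move=> mj; apply: (allP (idx_tuple_bound j)); rewrite mem_nth // size_idx_tuple.
Qed.

Variables (V : nmodType).
Implicit Type s : seq V.

Lemma leg_rcons_last j s b : ~~ odd j -> size s = j.+1 ->
  leg j.+1 (rcons s b) 2 = b.
Proof. by move=> ej ss; rewrite /leg idx_tupleS_even //= nth_rcons ss ltnn eqxx. Qed.

Lemma leg_cons_head j s b : odd j -> leg j.+1 (b :: s) 2 = b.
Proof. by move=> oj; rewrite /leg idx_tupleS_odd. Qed.

Lemma leg_rcons1 j s b : ~~ odd j -> size s = j.+1 ->
  leg j.+1 (rcons s b) 1 = leg j s 1.
Proof.
move=> ej ss; rewrite /leg idx_tupleS_even //= nth_rcons ss nth0.
by have /andP[i0 ij] := idx_tuple_nth (leq0n j); rewrite -nth0 prednK // ij.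
Qed.

Lemma leg_rcons j s b m : ~~ odd j -> size s = j.+1 -> (2 <= m <= j.+1)%N ->
  leg j.+1 (rcons s b) m.+1 = leg j s m.
Proof.
case: m => [|[|m]] // ej ss mj; rewrite /leg idx_tupleS_even //= nth_behead.
by rewrite nth_rcons ss; have /andP[i0 ij] := idx_tuple_nth (mj : (m.+1 <= j)%N); rewrite prednK // ij.
Qed.

Lemma leg_cons1 j s b : odd j -> leg j.+1 (b :: s) 1 = leg j s 1.
Proof.
move=> oj; rewrite /leg idx_tupleS_odd //= -nth0.
by have /andP[i0 ij] := idx_tuple_nth (leq0n j); rewrite -{1}(prednK i0).
Qed.

Lemma leg_cons j s b m : odd j -> (2 <= m <= j.+1)%N ->
  leg j.+1 (b :: s) m.+1 = leg j s m.
Proof.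
case: m => [|[|m]] // oj mj; rewrite /leg idx_tupleS_odd //=.
have /andP[i0 ij] := idx_tuple_nth (mj : (m.+1 <= j)%N).
rewrite (nth_map 0%N) ?size_behead ?size_idx_tuple // nth_behead /=.
by rewrite -{1}(prednK i0).
Qed.
End IndexTuple.

Lemma foldl_iotaS (T : Type) (f g : T -> nat -> T) x j :
  (forall y m, (2 <= m <= j.+1)%N -> f y m.+1 = g y m) ->
  foldl f x (iota 2 j.+1) = foldl g (f x 2) (iota 2 j).
Proof.
move=> fg; rewrite /= (iotaDl 1 2).
have : all (fun m => 2 <= m <= j.+1)%N (iota 2 j).
  by apply/allP => m; rewrite mem_iota.
elim: (iota 2 j) (f x 2) => //= m s IH y /andP[mj sj].
by rewrite -IH // add1n fg.
Qed.

(** * Powers of the antipode in the left argument *)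

Section IteratedAntipode.
Variables (k : fieldType) (H : hopfAlgType k).
Variables d c : {linear tensor H H -> H}.

Definition antipode_summand j (x : H) (s : seq H) : H :=
  iter j antipode (d (leg j s 1 ⊗
    foldl (fun y m => c (y ⊗ iter (j + 2 - m) antipode (leg j s m)))
          x (iota 2 j))).

Lemma antipode_summand_rcons j x s b : ~~ odd j -> size s = j.+1 ->
  antipode_summand j.+1 x (rcons s b) =
  antipode (antipode_summand j (c (x ⊗ iter j.+1 antipode b)) s).
Proof.
move=> ej ss; rewrite /antipode_summand leg_rcons1 //.
rewrite (foldl_iotaS (g := fun y m => c (y ⊗ iter (j + 2 - m) antipode (leg j s m)))).
  by rewrite leg_rcons_last // addnK.
by move=> y m mj; rewrite leg_rcons // addSn subSS.
Qed.

Lemma antipode_summand_cons j x s b : odd j ->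
  antipode_summand j.+1 x (b :: s) =
  antipode (antipode_summand j (c (x ⊗ iter j.+1 antipode b)) s).
Proof.
move=> oj; rewrite /antipode_summand leg_cons1 //.
rewrite (foldl_iotaS (g := fun y m => c (y ⊗ iter (j + 2 - m) antipode (leg j s m)))).
  by rewrite leg_cons_head // addnK.
by move=> y m mj; rewrite leg_cons // addSn subSS.
Qed.

(** Multilinearity in s rests on this: a step of the induction moves one entry of
    s into the argument x. *)
Lemma antipode_summand_linear j s :
  size s = j.+1 -> linear (antipode_summand j ^~ s).
Proof.
elim: j s => [|j IH] s ss; first by rewrite /antipode_summand /=; lin.
have L b t : size t = j.+1 ->
    linear (fun x => antipode (antipode_summand j (c (x ⊗ iter j.+1 antipode b)) t)).
  move=> st; apply: lin_fun => a x y.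
  by rewrite (tens_bilinear _ _).1 linearP (IH t st).
case oj: (odd j).
- case: s ss => [|b s] // [ss] a x y.
  by rewrite !antipode_summand_cons // (L b s ss).
- case/lastP: s ss => [|s b] //; rewrite size_rcons => - [ss] a x y.
  by rewrite !antipode_summand_rcons ?oj // (L b s ss).
Qed.

Lemma antipode_summand_multilinear j x : multilinear j (antipode_summand j x).
Proof.
elim: j x => [|j IH] x s t.
  move/eqP; rewrite addn_eq0 !size_eq0 => /andP[/eqP-> /eqP->].
  by rewrite /antipode_summand /=; lin.
have Lx u : size u = j.+1 -> linear (fun b =>
    antipode (antipode_summand j (c (x ⊗ iter j.+1 antipode b)) u)).
  move=> su; apply: lin_fun => a y z.
  by rewrite lin_iter (tens_bilinear _ _).2 linearP (antipode_summand_linear su).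
case oj: (odd j).
- case: s => [|b s] /=.
    rewrite add0n => st a y z; rewrite !antipode_summand_cons //; exact: Lx.
  move=> [st] a y z; rewrite !antipode_summand_cons //.
  by rewrite (IH _ s t) // linearP.
- case/lastP: t => [|t b] /=.
    rewrite addn0 => st a y z; rewrite !cats1 !antipode_summand_rcons ?oj //; exact: Lx.
  rewrite size_rcons addnS => - [st] a y z.
  have E w : s ++ w :: rcons t b = rcons (s ++ w :: t) b by rewrite rcons_cat.
  rewrite !E !antipode_summand_rcons ?oj ?size_cat /= ?addnS ?st //.
  by rewrite (IH _ s t) // linearP.
Qed.

Lemma comul_iter_antipode j (h : H) :
  comul (iter j antipode h) =
  \sw_(a, b <- h) (if odd j then iter j antipode b ⊗ iter j antipode a
                            else iter j antipode a ⊗ iter j antipode b).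
Proof.
elim: j => [|j IH] /=; first by rewrite sw_id.
rewrite comul_antipode IH; case: (odd j); rewrite tlift_tensors //; lin.
Qed.

Hypothesis d_antipode : forall h x,
  d (antipode h ⊗ x) = antipode (\sw_(a, b <- h) d (a ⊗ c (x ⊗ antipode b))).

(** The induction step splits h into the leg acted on by S^j, to which the
    induction hypothesis applies, and the leg b acted on by S^(j+1), which
    turns x into x ⦂ S^(j+1)(b). *)
Lemma dot_iter_antipode j h x :
  d (iter j antipode h ⊗ x) = iter_sw j (antipode_summand j x) h.
Proof.
elim: j h x => [|j IH] h x; first by [].
rewrite iterS d_antipode comul_iter_antipode.
case oj: (odd j); rewrite tlift_tensors; try by lin.
- rewrite (tlift_comp _ _ (linearP antipode)); apply: eq_tlift => a b.
  rewrite IH iter_sw_comp; apply: eq_iter_sw => s ss /=.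
  by rewrite antipode_summand_cons.
- rewrite (tlift_comp _ _ (linearP antipode)) iter_sw_rcons; last first.
    exact: antipode_summand_multilinear.
  apply: eq_tlift => a b.
  rewrite IH iter_sw_comp; apply: eq_iter_sw => s ss /=.
  by rewrite antipode_summand_rcons ?oj.
Qed.
End IteratedAntipode.

Unset Implicit Arguments.

Theorem proposition5p31 (k : fieldType) (H : hopfAlgType k)
    (dot colon : {linear tensor H H -> H}) (brace : hopf_q_brace dot colon)
    (j : nat) (hj : (0 < j)%N) (h x : H) :
  dot (iter j antipode h ⊗ x) =
    \sw[j]_(s <- h)
      iter j antipode (dot (leg j s 1 ⊗
        foldl (fun y m => colon (y ⊗ iter (j + 2 - m) antipode (leg j s m)))
              x (iota 2 j)))
  /\
  colon (iter j antipode h ⊗ x) =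
    \sw[j]_(s <- h)
      iter j antipode (colon (leg j s 1 ⊗
        foldl (fun y m => dot (y ⊗ iter (j + 2 - m) antipode (leg j s m)))
              x (iota 2 j))).
Proof.
case: brace => [[qmag _ _ _ _] [dot1 dotM] [colon1 colonM] mul_dot mul_colon].
have compat := dot_colon_compat qmag.
split; apply: dot_iter_antipode => {}h {}x.
- apply: dot_antipode => //; try by case: qmag.
  + exact: comul_dot qmag.
  + exact: comul_colon qmag.
  + move=> y; have := compat 1 y; rewrite !sw1; try by lin.
    under eq_tlift => y1 y2 do rewrite colon1.
    by under [in RHS]eq_tlift => y1 y2 do rewrite colon1.
- apply: dot_antipode => //; try by case: qmag.
  + exact: comul_colon qmag.
  + exact: comul_dot qmag.
  (* The first tensor factor is now the value of ⦂ at 1, so it must be flipped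
     into the second place. *)
  + move=> y; have := compat y 1.
    under eq_tlift => y1 y2 do (rewrite sw1 ?dot1; last by lin).
    under [in RHS]eq_tlift => y1 y2 do (rewrite sw1 ?dot1; last by lin).
    move/(congr1 (@tswap k H)); rewrite !(tlift_comp _ _ (linearP (@tswap k H))).
    under eq_tlift => y1 y2 do rewrite tswapE.
    by under [in RHS]eq_tlift => y1 y2 do rewrite tswapE.
Qed.
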